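(* Let $f:\mathbb{R}^n\to\mathbb{R}$ be convex and continuously differentiable with locally Lipschitz gradient, with $\mathcal{X}^*:=\arg\min f\neq\emptyset$ and optimal value $f^*$. Fix $x^0\in\mathbb{R}^n$, $\alpha_0>0$, $\theta_0>0$, $\tau\ge1$, $0<\omega\le\frac1{\sqrt2}$, and $\gamma_k$ with $0<\gamma_{\min}\le\gamma_k\le\gamma_{\max}$, and generate $x^{k+1}=x^k-\alpha_k\gamma_k\nabla f(x^k)$ with, for $k\ge1$, $L_k:=\frac{\|\nabla f(x^k)-\nabla f(x^{k-1})\|}{\|x^k-x^{k-1}\|}$, $\alpha_k:=\min\{\frac{\alpha_{k-1}\gamma_{k-1}}{\gamma_k}\sqrt{2(1-\omega^2)+\theta_{k-1}/\tau},\frac{\omega}{\gamma_kL_k}\}$, $\theta_k:=\frac{\alpha_k\gamma_k}{\alpha_{k-1}\gamma_{k-1}}$. Let $\eta:=\mathrm{dist}^2(x^0;\mathcal{X}^* )+2\alpha_0^2\gamma_0^2\|\nabla f(x^0)\|^2+2\alpha_0\gamma_0\theta_0(f(x^0)-f^* )$ and let $R>\sqrt\eta+\mathrm{dist}(x^0;\mathcal{X}^* )+\|x^0\|$. Then: (a) $x^k\in B(0;R)$ (open ball) for all $k$; in particular $(x^k)$ is bounded; (b) $\sum_{k\ge0}\|\nabla f(x^k)\|^2<\infty$ and $\lim_{k\to\infty}\|\nabla f(x^k)\|=0$; (c) $(x^k)$ converges to an optimal solution $x^*\in B(0;R)$.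
   Context: This is the adaptive scaled gradient algorithm (AdaSGA). $\mathrm{dist}(x;S)=\inf_{z\in S}\|z-x\|$. *)

(* Defs.v *)
From HB Require Import structures.
From mathcomp Require Import all_boot all_order all_algebra.
From mathcomp Require Import all_classical all_reals all_analysis.
Set Implicit Arguments. Unset Strict Implicit. Unset Printing Implicit Defensive.
Import Order.TTheory GRing.Theory Num.Theory.
Import numFieldNormedType.Exports.
Local Open Scope classical_set_scope.
Local Open Scope ring_scope.

Section AdaSGA.
Variables (R : realType) (n : nat).

Definition dotv (u v : 'rV[R]_n) : R := \sum_(i < n) u 0 i * v 0 i.
Definition enorm (v : 'rV[R]_n) : R := Num.sqrt (dotv v v).

Definition grad (f : 'rV[R]_n -> R) (x : 'rV[R]_n) : 'rV[R]_n :=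
  \row_(i < n) ('d f x) (delta_mx 0 i : 'rV[R]_n).

Definition convex_fun (f : 'rV[R]_n -> R) : Prop :=
  forall (x y : 'rV[R]_n) (t : R), 0 <= t <= 1 ->
    f (t *: x + (1 - t) *: y) <= t * f x + (1 - t) * f y.

Definition locally_lipschitz (g : 'rV[R]_n -> 'rV[R]_n) : Prop :=
  forall x, exists2 r : R, 0 < r & exists L : R, forall y z,
    enorm (y - x) < r -> enorm (z - x) < r -> enorm (g y - g z) <= L * enorm (y - z).

Definition argmin (f : 'rV[R]_n -> R) : set 'rV[R]_n :=
  [set x | forall y, f x <= f y].

Definition optval (f : 'rV[R]_n -> R) : R := inf (range f).

Definition dist_set (x : 'rV[R]_n) (S : set 'rV[R]_n) : R :=
  inf [set enorm (z - x) | z in S].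

(* AdaSGA iteration.  State at step k : (x^k, alpha_k, theta_k).
   L_{k+1} = |grad f(x^{k+1}) - grad f(x^k)| / |x^{k+1} - x^k|; when L_{k+1} = 0
   (including the degenerate 0/0 case, where MathComp's division gives 0) the
   term omega/(gamma L) is +oo and the min is the first term. *)
Definition ada_step (f : 'rV[R]_n -> R) (gamma : nat -> R) (tau omega : R)
    (k : nat) (s : 'rV[R]_n * R * R) : 'rV[R]_n * R * R :=
  let: (xk, ak, thk) := s in
  let xk1 := xk - (ak * gamma k) *: grad f xk in
  let Lk1 := enorm (grad f xk1 - grad f xk) / enorm (xk1 - xk) in
  let t1 := ak * gamma k / gamma k.+1 *
            Num.sqrt (2 * (1 - omega ^+ 2) + thk / tau) in
  let ak1 := if Lk1 == 0 then t1 else Num.min t1 (omega / (gamma k.+1 * Lk1)) in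
  let thk1 := ak1 * gamma k.+1 / (ak * gamma k) in
  (xk1, ak1, thk1).

Fixpoint ada_state (f : 'rV[R]_n -> R) (gamma : nat -> R)
    (x0 : 'rV[R]_n) (alpha0 theta0 tau omega : R) (k : nat) : 'rV[R]_n * R * R :=
  match k with
  | 0 => (x0, alpha0, theta0)
  | k'.+1 => ada_step f gamma tau omega k'
               (ada_state f gamma x0 alpha0 theta0 tau omega k')
  end.

Definition ada_x f gamma x0 alpha0 theta0 tau omega k : 'rV[R]_n :=
  (ada_state f gamma x0 alpha0 theta0 tau omega k).1.1.

End AdaSGA.

(* Main.v *)
Require Import Defs.
From mathcomp Require Import all_boot all_order all_algebra.
From mathcomp Require Import all_classical all_reals all_analysis.
From mathcomp Require Import ring lra.
Set Implicit Arguments.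
Unset Strict Implicit.
Import Order.TTheory GRing.Theory Num.Theory.
Import numFieldNormedType.Exports.
Local Open Scope classical_set_scope.
Local Open Scope ring_scope.

                                                                                  
                                                                                  
                                     
                                                                                              
                                                                                     
                                                                          
                             
                                                                            
                                                                                     
                                                                                      
                                                                                        
                                                                                    
                                                                                       
                                                                                          

(** Only the effective step [lam k], the product of alpha_k and gamma_k, enters the argument. Write
    g_k for the gradient at x^k. For a minimizer y and w = 1/(1 - omega^2), the energy [V y k] adds
    to the squared distance from x^{k+1} to y a multiple of lam_k^2 |g_k|^2 and a multiple of the
    optimality gap at x^k. Convexity and the rule lam_{k+1} |g_{k+1} - g_k| <= omega |x^{k+1} - x^k|
    control the next squared displacement ([gradient_step_residual]). The growth rule theta_{k+1}^2
    <= 2(1 - omega^2) + theta_k then makes the coefficients of the gap fit together, so [V y] never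
    increases ([lyapunov_step]). Since w <= 2, [V y 0] is at most the variant of eta in which the
    distance to the solution set is replaced by |x^0 - y|. Choosing y almost nearest to x^0 yields
    (a).

    For (b), the iterates stay in a compact ball around y, on which the gradient has a single
    Lipschitz constant L. There the gradient inequality improves by |g_k|^2/(4L)
    ([cocoercive_at_critical_point]), so the energy pays for each squared gradient, with a weight
    bounded below because the steps are ([stepsize_ge]). Telescoping bounds the series.

    For (c), cluster points are critical, hence optimal. The energies of two minimizers differ only
    in their distance terms, so the difference of squared distances converges. This is enough for a
    unique cluster point ([opial_cvg]), with no need for the other terms of the energy to vanish. *)

(** * Euclidean inner product and norm on row vectors *)

Section Euclidean.
Variables (R : realType) (n : nat).
Implicit Types (u v w : 'rV[R]_n) (a : R).

Lemma dotvC u v : dotv u v = dotv v u.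
Proof. by apply: eq_bigr => i _; rewrite mulrC. Qed.

Lemma dotvDl u v w : dotv (u + v) w = dotv u w + dotv v w.
Proof. by rewrite -big_split; apply: eq_bigr => i _; rewrite mxE mulrDl. Qed.

Lemma dotvZl a u v : dotv (a *: u) v = a * dotv u v.
Proof. by rewrite mulr_sumr; apply: eq_bigr => i _; rewrite mxE mulrA. Qed.

Lemma dotvNl u v : dotv (- u) v = - dotv u v.
Proof. by rewrite -scaleN1r dotvZl mulN1r. Qed.

Lemma dotvDr u v w : dotv u (v + w) = dotv u v + dotv u w.
Proof. by rewrite dotvC dotvDl !(dotvC u). Qed.

Lemma dotvZr a u v : dotv u (a *: v) = a * dotv u v.
Proof. by rewrite dotvC dotvZl (dotvC u). Qed.

Lemma dotvNr u v : dotv u (- v) = - dotv u v.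
Proof. by rewrite dotvC dotvNl (dotvC u). Qed.

Lemma dotv_ge0 u : 0 <= dotv u u.
Proof. by apply: sumr_ge0 => i _; rewrite -expr2 sqr_ge0. Qed.

Lemma dotv_eq0 u : (dotv u u == 0) = (u == 0).
Proof.
apply/eqP/eqP => [|->]; last by rewrite -(scale0r 0) dotvZl mul0r.
move/psumr_eq0P => u0; apply/rowP => i; rewrite mxE; apply/eqP.
by rewrite -sqrf_eq0 expr2 u0// => j _; rewrite -expr2 sqr_ge0.
Qed.

Lemma enorm_ge0 u : 0 <= enorm u.
Proof. exact: sqrtr_ge0. Qed.

Lemma sqr_enorm u : enorm u ^+ 2 = dotv u u.
Proof. by rewrite sqr_sqrtr // dotv_ge0. Qed.

Lemma enorm_eq0 u : (enorm u == 0) = (u == 0).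
Proof. by rewrite sqrtr_eq0 -dotv_eq0 eq_le dotv_ge0 andbT. Qed.

Lemma enormZ a u : enorm (a *: u) = `|a| * enorm u.
Proof.
by rewrite /enorm dotvZl dotvZr mulrA -expr2 sqrtrM ?sqr_ge0// sqrtr_sqr.
Qed.

Lemma enormN u : enorm (- u) = enorm u.
Proof. by rewrite -scaleN1r enormZ normrN1 mul1r. Qed.

Lemma enorm_distC u v : enorm (u - v) = enorm (v - u).
Proof. by rewrite -opprB enormN. Qed.

(** Cauchy-Schwarz, by expanding the nonnegative square of |v| u - |u| v and dividing by |u| |v|. *)
Lemma dotv_le_enorm u v : dotv u v <= enorm u * enorm v.
Proof.
have [->|u0] := eqVneq u 0.
  by rewrite -(scale0r 0) dotvZl mul0r enormZ normr0 !mul0r.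
have [->|v0] := eqVneq v 0.
  by rewrite -(scale0r 0) dotvZr mul0r enormZ normr0 mul0r mulr0.
have pu : 0 < enorm u by rewrite lt_def enorm_eq0 u0 enorm_ge0.
have pv : 0 < enorm v by rewrite lt_def enorm_eq0 v0 enorm_ge0.
have := dotv_ge0 (enorm v *: u - enorm u *: v).
rewrite !(dotvDl, dotvDr, dotvNl, dotvNr, dotvZl, dotvZr) -!sqr_enorm (dotvC v u).
set d := dotv u v; set p := enorm u; set q := enorm v => h.
rewrite -subr_ge0 -(pmulr_rge0 _ (mulr_gt0 pu pv)).
by move: h; rewrite -/p -/q; nra.
Qed.

Lemma ler_enormD u v : enorm (u + v) <= enorm u + enorm v.
Proof.
have h := dotv_le_enorm u v.
rewrite -(@ler_pXn2r _ 2) ?nnegrE ?addr_ge0 ?enorm_ge0//.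
rewrite sqrrD !sqr_enorm !(dotvDl, dotvDr) (dotvC v u); nra.
Qed.

Lemma ler_enorm_dist u v w : enorm (u - w) <= enorm (u - v) + enorm (v - w).
Proof. by rewrite -[u - w](subrKA v) ler_enormD. Qed.

(** The ambient norm is the max norm; this comparison transfers boundedness to it from the Euclidean
    norm. *)
Lemma ler_norm_enorm u : `|u| <= enorm u.
Proof.
rewrite /Num.Def.normr/= mx_normrE; apply: bigmax_le => [|[i j] _ /=].
  exact: enorm_ge0.
rewrite ord1 -sqrtr_sqr ler_wsqrtr// /dotv (bigD1 j)//= -expr2 lerDl.
by apply: sumr_ge0 => k _; rewrite -expr2 sqr_ge0.
Qed.

Lemma continuous_enorm : continuous (@enorm R n).
Proof.
have dc : continuous (fun v : 'rV[R]_n => dotv v v).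
  apply: continuous_big => [z|i _ v].
    by apply: cvgD; [exact: cvg_fst|exact: cvg_snd].
  have ci := @coord_continuous R 1 n 0 i v.
  exact: (cvgM ci ci).
by move=> u; apply: (continuous_comp (dc u)); exact: sqrt_continuous.
Qed.

Lemma cvg_enorm (T : Type) (F : set_system T) (FF : Filter F) (h : T -> 'rV[R]_n) u :
  h @ F --> u -> enorm (h t) @[t --> F] --> enorm u.
Proof. by move=> hu; apply: (cvg_comp _ _ hu); exact: continuous_enorm. Qed.

Lemma cvg_enormB (T : Type) (F : set_system T) (FF : Filter F) (h : T -> 'rV[R]_n) u v :
  h @ F --> u -> enorm (h t - v) @[t --> F] --> enorm (u - v).
Proof.
move=> hu; apply: (@cvg_enorm _ _ _ (fun t => h t - v)).
by apply: cvgB hu _; exact: cvg_cst.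
Qed.

Lemma enorm_near (u : 'rV[R]_n) (e : R) : 0 < e -> \forall v \near u, enorm (v - u) < e.
Proof.
move=> e0; have : enorm (v - u) @[v --> u] --> enorm (u - u).
  exact: (@cvg_enormB _ (nbhs u) _ id).
move/cvgrPdist_lt => /(_ e e0); apply: filterS => v.
have -> : enorm (u - u) = 0 by apply/eqP; rewrite enorm_eq0 subrr.
by rewrite sub0r normrN ger0_norm ?enorm_ge0.
Qed.

Lemma compact_enorm_ball u (D : R) : compact [set v | enorm (v - u) <= D].
Proof.
apply: bounded_closed_compact.
  exists (D + enorm u); split; first exact: num_real.
  move=> M DM v /= vD; apply: (le_trans (ler_norm_enorm v)); apply: ltW.
  apply: le_lt_trans DM; rewrite -{1}[v](subrK u).
  by apply: (le_trans (ler_enormD _ _)); rewrite lerD2r.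
have -> : [set v | enorm (v - u) <= D] = (fun v => enorm (v - u)) @^-1` [set x | x <= D].
  by [].
apply: closed_comp; last exact: closed_le.
move=> v _; exact: (@cvg_enormB _ (nbhs v) _ id).
Qed.

End Euclidean.

(** * First-order conditions for differentiable convex functions *)

Section ConvexGradient.
Variables (R : realType) (n : nat) (f : 'rV[R]_n -> R).
Implicit Types (x y z u v : 'rV[R]_n).

Lemma diff_grad x v : 'd f x v = dotv (grad f x) v.
Proof.
rewrite [v in LHS]row_sum_delta linear_sum; apply: eq_bigr => i _.
by rewrite linearZ mxE mulrC.
Qed.

Lemma right_difference_quotient_cvg x v : differentiable f x ->
  h^-1 * (f (h *: v + x) - f x) @[h --> (0 : R)^'+] --> dotv (grad f x) v.
Proof.
move=> df; rewrite -diff_grad -deriveE// => P.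
move/(diff_derivable (v := v) df); rewrite /nbhs/= /dnbhs /at_right /within/=.
by apply: filterS => h Ph h0; apply: Ph; rewrite gt_eqF.
Qed.

Hypothesis df : forall x, differentiable f x.

(** The derivative in the direction of the negative gradient is -|grad f x|^2, yet it is a limit of
    nonnegative quotients. *)
Lemma argmin_grad x : argmin f x -> grad f x = 0.
Proof.
move=> xmin; apply/eqP; rewrite -dotv_eq0 eq_le dotv_ge0 andbT -oppr_ge0 -dotvNr.
apply: (cvgr_to_ge (right_difference_quotient_cvg (v := - grad f x) (df x))).
near=> h; apply: mulr_ge0; last by rewrite subr_ge0 xmin.
by rewrite invr_ge0; apply: ltW; near: h; exact: nbhs_right_gt.
Unshelve. all: by end_near. Qed.

Hypothesis fconv : convex_fun f.

(** By convexity each difference quotient along y - x with step in (0, 1] is at most f y - f x; let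
    the step tend to 0. *)
Lemma convex_grad_le x y : f x + dotv (grad f x) (y - x) <= f y.
Proof.
rewrite addrC -lerBrDr.
apply: (cvgr_to_le (right_difference_quotient_cvg (v := y - x) (df x))).
near=> h.
have h0 : 0 < h by near: h; exact: nbhs_right_gt.
have h1 : h <= 1 by near: h; exact: nbhs_right_le.
rewrite ler_pdivrMl//.
have -> : h *: (y - x) + x = h *: y + (1 - h) *: x.
  by rewrite scalerBr scalerBl scale1r -addrA [- _ + _]addrC.
have := @fconv y x h; rewrite h1 ltW// => /(_ isT); lra.
Unshelve. all: by end_near. Qed.

End ConvexGradient.

(** * Consequences of the gradient inequality alone *)

Section GradientInequality.
Variables (R : realType) (n : nat) (f : 'rV[R]_n -> R) (g : 'rV[R]_n -> 'rV[R]_n).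
Hypothesis gle : forall x y, f x + dotv (g x) (y - x) <= f y.
Implicit Types (x y z : 'rV[R]_n).

Lemma critical_argmin x : g x = 0 -> argmin f x.
Proof.
by move=> gx0 y; have := gle x y; rewrite gx0 -(scale0r 0) dotvZl mul0r addr0.
Qed.

Lemma gradient_monotone x y : 0 <= dotv (g y - g x) (y - x).
Proof.
have := gle x y; have := gle y x.
rewrite -(opprB y x) dotvNr dotvDl dotvNl; lra.
Qed.

                                                                          
(** A local form of cocoercivity. The gradient inequality is used from x to an auxiliary point and
    from that point to [c]. Because [c] is the centre of the ball, the auxiliary point stays where
    the Lipschitz bound holds. *)
Lemma cocoercive_at_critical_point (c x : 'rV[R]_n) (D L : R) : 0 < L ->
  (forall y z, enorm (y - c) <= D -> enorm (z - c) <= D ->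
     enorm (g y - g z) <= L * enorm (y - z)) ->
  g c = 0 -> enorm (x - c) <= D ->
  f x - f c + dotv (g x) (c - x) <= - (enorm (g x) ^+ 2 / (4 * L)).
Proof.
move=> L0 lip gc0 xD.
have cD : enorm (c - c) <= D.
  by apply: le_trans xD; rewrite subrr -(scale0r 0) enormZ normr0 mul0r enorm_ge0.
have gxD : enorm (g x) <= L * enorm (x - c).
  by have := lip x c xD cD; rewrite gc0 subr0.
pose s := (2 * L)^-1; have s0 : 0 < s by rewrite invr_gt0 mulr_gt0.
have sL : s * L = 2^-1 by rewrite /s; field; rewrite gt_eqF.
(* As |g x| <= L |x - c|, this point is within |x - c| / 2 of [c], and its gradient has norm at most
   |g x| / 2. Of the gain s |g x|^2, half therefore survives. *)
pose y := c + s *: g x.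
have yc : y - c = s *: g x by rewrite /y addrC addKr.
have nyc : enorm (y - c) = s * enorm (g x) by rewrite yc enormZ gtr0_norm.
have yD : enorm (y - c) <= D.
  apply: le_trans xD; rewrite nyc; have := enorm_ge0 (x - c); nra.
have h1 := gle y c.
have h2 := gle x y.
have gy : enorm (g y) <= L * enorm (y - c).
  by have := lip y c yD cD; rewrite gc0 subr0.
have h3 := dotv_le_enorm (g y) (g x).
have -> : enorm (g x) ^+ 2 / (4 * L) = s * enorm (g x) ^+ 2 / 2.
  by rewrite /s; field; rewrite gt_eqF.
move: h1 h2 h3; rewrite -(opprB y c) yc !(dotvNr, dotvZr).
have -> : y - x = s *: g x + (c - x) by rewrite -yc subrKA.
rewrite (dotvDr (g x) (s *: g x)) dotvZr -sqr_enorm.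
move: gy; rewrite nyc mulrA (mulrC L) sL.
set G := enorm (g x); set H := enorm (g y); set d := dotv _ (g x).
have := enorm_ge0 (g x); rewrite -/G => G0 gy h1 h2 h3.
have : H * G <= 2^-1 * G * G by rewrite ler_wpM2r.
rewrite expr2 in h2 *; nra.
Qed.

End GradientInequality.

(** * From local Lipschitz continuity to a uniform constant on compact sets *)

Section LocallyLipschitz.
Variables (R : realType) (n : nat) (g : 'rV[R]_n -> 'rV[R]_n).
Implicit Types (x y z : 'rV[R]_n).

(** On the diagonal this is the hypothesis. Off it, |u - v| stays away from 0 near the pair while |g
    u - g v| stays bounded, so the quotient is bounded. *)
Lemma locally_lipschitz_near_pair y z : locally_lipschitz g ->
  exists C : R, \forall p \near (y, z),
    enorm (g p.1 - g p.2) <= C * enorm (p.1 - p.2).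
Proof.
move=> lip; have [->|yz] := eqVneq y z.
  have [r r0 [L Lr]] := lip z; exists L.
  exists ([set v | enorm (v - z) < r], [set v | enorm (v - z) < r]).
    by split; exact: enorm_near.
  by move=> [u v] /= [ur vr]; exact: Lr.
have d0 : 0 < enorm (y - z) by rewrite lt_def enorm_eq0 subr_eq0 yz enorm_ge0.
have [r1 r10 [L1 Lr1]] := lip y; have [r2 r20 [L2 Lr2]] := lip z.
set d := enorm (y - z) in d0 *.
(* A triangle-inequality bound on |g u - g v| through [g y] and [g z], divided by the lower bound d
   / 2 for |u - v|. *)
pose C := (`|L1| * d + enorm (g y - g z) + `|L2| * d) / d * 2.
exists C.
exists ([set v | enorm (v - y) < Num.min r1 (d / 4)],
        [set v | enorm (v - z) < Num.min r2 (d / 4)]).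
  by split; apply: enorm_near; rewrite lt_min ?r10 ?r20 divr_gt0.
move=> [u v] /= []; rewrite !lt_min => /andP[ur ud] /andP[vr vd].
have uu (x : 'rV[R]_n) (r : R) : 0 < r -> enorm (x - x) < r.
  by move=> r0; rewrite subrr -(scale0r 0) enormZ normr0 mul0r.
have h1 : enorm (g u - g y) <= `|L1| * d.
  apply: (le_trans (Lr1 u y ur (uu _ _ r10))).
  apply: (@le_trans _ _ (`|L1| * enorm (u - y))).
    by rewrite ler_wpM2r ?enorm_ge0 ?ler_norm.
  by rewrite ler_wpM2l// ltW// (lt_trans ud)//; lra.
have h2 : enorm (g z - g v) <= `|L2| * d.
  rewrite enorm_distC; apply: (le_trans (Lr2 v z vr (uu _ _ r20))).
  apply: (@le_trans _ _ (`|L2| * enorm (v - z))).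
    by rewrite ler_wpM2r ?enorm_ge0 ?ler_norm.
  by rewrite ler_wpM2l// ltW// (lt_trans vd)//; lra.
have h3 : d / 2 <= enorm (u - v).
  have := ler_enorm_dist y u z; have := ler_enorm_dist u v z.
  rewrite -/d (enorm_distC y u); lra.
have h4 := ler_enorm_dist (g u) (g y) (g v).
have h5 := ler_enorm_dist (g y) (g z) (g v).
have C0 : 0 <= C.
  apply: mulr_ge0 => //; apply: divr_ge0; last exact: ltW.
  by rewrite !addr_ge0 ?enorm_ge0// mulr_ge0// ltW.
apply: (@le_trans _ _ (C * (d / 2))); last by rewrite ler_wpM2l.
have -> : C * (d / 2) = `|L1| * d + enorm (g y - g z) + `|L2| * d.
  by rewrite /C; field; rewrite gt_eqF.
lra.
Qed.

Lemma locally_lipschitz_compact (K : set 'rV[R]_n) :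
  locally_lipschitz g -> compact K ->
  exists2 L : R, 0 < L & forall y z, K y -> K z ->
    enorm (g y - g z) <= L * enorm (y - z).
Proof.
move=> lip cK.
(* The constant is a parameter tending to infinity: each pair has a neighbourhood on which all large
   constants work, and compactness of the product makes one constant work everywhere. *)
have /compact_near_coveringP/(_ R +oo%R) := compact_setX cK cK.
move=> /(_ (fun M p => enorm (g p.1 - g p.2) <= M * enorm (p.1 - p.2)) _).
move=> /(_ _)[|M [Mr HM]].
  move=> [y z] _; have [C HC] := locally_lipschitz_near_pair y z lip.
  exists ([set p | enorm (g p.1 - g p.2) <= C * enorm (p.1 - p.2)], [set M | C <= M]).
    by split => //=; exact: nbhs_pinfty_ge (num_real C).
  move=> [p M] /= [pC CM]; apply: (le_trans pC).
  by rewrite ler_wpM2r ?enorm_ge0.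
exists (`|M| + 1); first by rewrite ltr_wpDl.
move=> y z Ky Kz; apply: (HM (`|M| + 1) _ (y, z)) => //=.
by rewrite (le_lt_trans (ler_norm M))// ltrDl.
Qed.

End LocallyLipschitz.

(** * Cluster points and an Opial-type criterion *)

Section Convergence.
Variables (R : realType) (n : nat).

Lemma cluster_cvg_continuous (T : topologicalType) (F : set_system T) (phi : T -> R)
    (z : T) (l : R) :
  cluster F z -> {for z, continuous phi} -> phi @ F --> l -> phi z = l.
Proof.
move=> zF cphi Fl; apply: (@Rhausdorff R) => A B Az Bl.
have [u [uB uA]] := zF _ _ (Fl _ Bl) (cphi _ Az).
by exists (phi u).
Qed.

Lemma locally_lipschitz_enorm_continuous (g : 'rV[R]_n -> 'rV[R]_n) :
  locally_lipschitz g -> continuous (fun u => enorm (g u)).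
Proof.
move=> lip z; have [r r0 [L Lr]] := lip z.
suff : enorm (g u) @[u --> z] --> enorm (g z) by [].
apply: (proj2 (cvgrPdist_lt (F := nbhs z) (FF := nbhs_filter z) (fun u => enorm (g u)) _)) => e e0.
have L0 : 0 < `|L| + 1 by rewrite ltr_wpDl.
have : \forall u \near z, enorm (u - z) < Num.min r (e / (`|L| + 1)).
  by apply: enorm_near; rewrite lt_min r0 divr_gt0.
apply: (@filterS _ (nbhs z) (nbhs_filter z)) => u; rewrite lt_min ltr_pdivlMr// => /andP[ur ue].
have zr : enorm (z - z) < r by rewrite subrr -(scale0r 0) enormZ normr0 mul0r.
have h := Lr u z ur zr.
have hL : L * enorm (u - z) <= (`|L| + 1) * enorm (u - z).
  by rewrite ler_wpM2r ?enorm_ge0// (le_trans (ler_norm L))// lerDl.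
have h1 : enorm (g u) <= enorm (g u - g z) + enorm (g z).
  by rewrite -{1}[g u](subrK (g z)) ler_enormD.
have h2 : enorm (g z) <= enorm (g u - g z) + enorm (g u).
  by rewrite (enorm_distC (g u)) -{1}[g z](subrK (g u)) ler_enormD.
rewrite ltr_norml; lra.
Qed.

                                                                                
                                                                                 
(** If l is the limit of |x_k - z|^2 - |x_k - z'|^2 for cluster points z and z', continuity at z
    gives l = -|z - z'|^2 and at z' gives l = |z - z'|^2. So z = z', and a bounded sequence with one
    cluster point converges. *)
Lemma opial_cvg (x : nat -> 'rV[R]_n) (y : 'rV[R]_n) (D : R) :
  (forall k, enorm (x k - y) <= D) ->
  (forall z1 z2, cluster (x @ \oo) z1 -> cluster (x @ \oo) z2 ->
     cvg (enorm (x k - z1) ^+ 2 - enorm (x k - z2) ^+ 2 @[k --> \oo])) ->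
  exists2 z, cluster (x @ \oo) z & x k @[k --> \oo] --> z.
Proof.
move=> xD clcvg.
have [] := @compact_enorm_ball R n y D (x @ \oo) _.
  by exists 0%N => // k _; exact: xD.
move=> z [zD zcl]; exists z => //.
(* The radius is enlarged by 1 so that the compact ball is a neighbourhood of [z], which may lie on
   the sphere of radius [D]. *)
apply: (@compact_cluster_set1 _ _ _ [set v | enorm (v - y) <= D + 1]).
- exact: norm_hausdorff.
- exact: compact_enorm_ball.
- apply: (@filterS _ (nbhs z) (nbhs_filter z) _ _ _ (enorm_near z ltr01)) => v vz /=.
  have := ler_enorm_dist v z y; move: zD vz => /=; lra.
- by exists 0%N => // k _ /=; have := xD k; lra.
apply/seteqP; split => [z' z'cl|_ ->//].
pose phi u := enorm (u - z) ^+ 2 - enorm (u - z') ^+ 2.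
have cphi u : {for u, continuous phi}.
  have c v : enorm (w - v) @[w --> u] --> enorm (u - v).
    exact: (@cvg_enormB _ _ _ (nbhs u) _ id).
  have c2 v : enorm (w - v) ^+ 2 @[w --> u] --> enorm (u - v) ^+ 2.
    exact: (cvgM (c v) (c v)).
  exact: (cvgB (c2 z) (c2 z')).
have /cvg_ex[l xl] := clcvg z z' zcl z'cl.
have e1 := cluster_cvg_continuous zcl (cphi z) xl.
have e2 := cluster_cvg_continuous z'cl (cphi z') xl.
have e v : enorm (v - v) = 0 :> R by apply/eqP; rewrite enorm_eq0 subrr.
apply/eqP; rewrite -subr_eq0 -enorm_eq0 -sqrf_eq0.
move: e2; rewrite -e1 /phi !e (enorm_distC z z') expr0n/=; lra.
Qed.

End Convergence.

(** * Energy analysis of an abstract gradient method with adaptive steps *)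

Section AdaptiveDescent.
Variables (R : realType) (n : nat) (f : 'rV[R]_n -> R) (g : 'rV[R]_n -> 'rV[R]_n).
Variables (x : nat -> 'rV[R]_n) (lam th : nat -> R) (om : R).
Hypothesis gle : forall y z, f y + dotv (g y) (z - y) <= f z.
Hypotheses (om_gt0 : 0 < om) (om2 : 2 * om ^+ 2 <= 1).
Hypotheses (lam_gt0 : forall k, 0 < lam k) (th0_gt0 : 0 < th 0).
Hypothesis xS : forall k, x k.+1 = x k - lam k *: g (x k).
Hypothesis thS : forall k, th k.+1 = lam k.+1 / lam k.
Hypothesis th_sqr : forall k, th k.+1 ^+ 2 <= 2 * (1 - om ^+ 2) + th k.
Hypothesis lam_grad : forall k,
  lam k.+1 * enorm (g (x k.+1) - g (x k)) <= om * enorm (x k.+1 - x k).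

Variable w : R.
Hypothesis wE : w * (1 - om ^+ 2) = 1.
Let A k := lam k ^+ 2 * enorm (g (x k)) ^+ 2.
(** The Lyapunov energy. It mixes indices: the distance is taken at [x k.+1], the other terms at
    [x k]. *)
Let V y k := enorm (x k.+1 - y) ^+ 2 + (w - 1) * A k
  + (2 * lam k + w * lam k * th k) * (f (x k) - f y).

Let w_ge1 : 1 <= w.
Proof.
have c0 : 0 < 1 - om ^+ 2 by move: om2; lra.
by rewrite -(ler_pM2r c0) wE mul1r gerBl sqr_ge0.
Qed.

Let w_le2 : w <= 2.
Proof.
have : w * 2^-1 <= w * (1 - om ^+ 2).
  by rewrite ler_wpM2l ?(le_trans ler01 w_ge1)//; move: om2; lra.
by rewrite wE; lra.
Qed.

Let th_gt0 k : 0 < th k.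
Proof. by case: k => [//|k]; rewrite thS divr_gt0. Qed.

Let A_ge0 k : 0 <= A k.
Proof. by rewrite mulr_ge0 ?sqr_ge0. Qed.

(** Expanding the square of [lam_grad] leaves an inner product of consecutive gradients. One copy is
    absorbed by monotonicity of the gradient, and the other is bounded by the decrease of [f]
    through the gradient inequality. *)
Lemma gradient_step_residual k :
  A k.+1 <= om ^+ 2 * A k + lam k.+1 * th k.+1 * (f (x k) - f (x k.+1)).
Proof.
have dx : x k.+1 - x k = - lam k *: g (x k) by rewrite xS addrC addKr scaleNr.
have h1 : f (x k.+1) + lam k * dotv (g (x k.+1)) (g (x k)) <= f (x k).
  by have := gle (x k.+1) (x k); rewrite -opprB dx scaleNr opprK dotvZr.
have h2 : dotv (g (x k.+1)) (g (x k)) <= dotv (g (x k)) (g (x k)).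
  have := gradient_monotone gle (x k) (x k.+1).
  by rewrite dx dotvZr dotvDl dotvNl mulNr -mulrN opprD opprK pmulr_rge0// addrC subr_ge0.
have h3 : lam k.+1 ^+ 2 * (dotv (g (x k.+1)) (g (x k.+1))
     - 2 * dotv (g (x k.+1)) (g (x k)) + dotv (g (x k)) (g (x k)))
   <= om ^+ 2 * (lam k ^+ 2 * dotv (g (x k)) (g (x k))).
  have : (lam k.+1 * enorm (g (x k.+1) - g (x k))) ^+ 2 <= (om * enorm (x k.+1 - x k)) ^+ 2.
    by rewrite ler_pXn2r// nnegrE mulr_ge0 ?enorm_ge0// ltW.
  rewrite !exprMn dx enormZ normrN (gtr0_norm (lam_gt0 k)) exprMn !sqr_enorm.
  rewrite dotvDl !dotvDr !dotvNl !dotvNr (dotvC (g (x k))) opprK.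
  by apply: le_trans; rewrite le_eqVlt; apply/orP; left; apply/eqP; ring.
rewrite /A thS !sqr_enorm.
move: h1 h2 h3 (lam_gt0 k) (lam_gt0 k.+1).
set p := dotv (g (x k)) (g (x k)); set q := dotv (g (x k.+1)) (g (x k.+1)).
set s := dotv _ (g (x k)); set a := lam k; set b := lam k.+1.
move: (f (x k)) (f (x k.+1)) => F F' h1 h2 h3 a0 b0.
have h4 : b ^+ 2 * s <= b ^+ 2 * p by rewrite ler_wpM2l ?sqr_ge0.
have h5 : b ^+ 2 * s <= b * (b / a) * (F - F').
  have -> : b ^+ 2 * s = b * (b / a) * (a * s) by field; rewrite gt_eqF.
  by apply: ler_wpM2l; [rewrite ltW// mulr_gt0 ?divr_gt0|lra].
lra.
Qed.

Lemma gradient_step_dist y e k :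
  f (x k) - f y + dotv (g (x k)) (y - x k) <= - e ->
  enorm (x k.+1 - y) ^+ 2 <=
    enorm (x k - y) ^+ 2 - 2 * lam k * (f (x k) - f y + e) + A k.
Proof.
have -> : x k.+1 - y = (x k - y) - lam k *: g (x k) by rewrite xS addrAC.
rewrite -(opprB (x k) y) dotvNr /A.
rewrite !sqr_enorm; move: (x k - y) (g (x k)) => u v h.
rewrite dotvDl !dotvDr !dotvNl !dotvNr !dotvZl !dotvZr (dotvC u v).
have := ler_wpM2l (ltW (lam_gt0 k)) h; lra.
Qed.

(** The distance estimate contributes one [A k.+1], which with the w - 1 copies in the energy makes
    w copies; w times the residual bound turns them into terms at index k. The number [e] is any
    surplus in the gradient inequality: 0 gives monotonicity, a cocoercive surplus gives
    summability. *)
Lemma lyapunov_step y e k : argmin f y ->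
  f (x k.+1) - f y + dotv (g (x k.+1)) (y - x k.+1) <= - e ->
  V y k.+1 + 2 * lam k.+1 * e <= V y k.
Proof.
move=> ymin /gradient_step_dist hd.
have hr := gradient_step_residual k.
have F0 : 0 <= f (x k) - f y by rewrite subr_ge0 ymin.
have ht : w * lam k.+1 * th k.+1 <= lam k * (2 + w * th k).
  have -> : lam k.+1 = lam k * th k.+1.
    by rewrite thS mulrCA mulfV ?mulr1// gt_eqF.
  have -> : w * (lam k * th k.+1) * th k.+1 = lam k * (w * th k.+1 ^+ 2) by ring.
  rewrite ler_pM2l//; apply: (@le_trans _ _ (w * (2 * (1 - om ^+ 2) + th k))).
    by rewrite ler_wpM2l ?th_sqr// (le_trans _ w_ge1).
  by rewrite mulrDr mulrCA wE mulr1.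
have hw : w * A k.+1 <= (w - 1) * A k
    + w * lam k.+1 * th k.+1 * (f (x k) - f (x k.+1)).
  (* This identity dictates the choice of w: the contracted part of the residual reproduces the
     coefficient w - 1 of the energy. *)
  have -> : w - 1 = w * om ^+ 2 by move: wE; lra.
  have := ler_wpM2l (le_trans ler01 w_ge1) hr; lra.
have hF := ler_wpM2r F0 ht.
rewrite /V; move: hd hw hF; move: (enorm _ ^+ 2) (enorm _ ^+ 2) => a b.
move: (A k) (A k.+1) (f (x k)) (f (x k.+1)) (f y) => A0 A1 G0 G1 G; lra.
Qed.

Definition initial_bound y := enorm (x 0 - y) ^+ 2
  + 2 * (lam 0 ^+ 2 * enorm (g (x 0)) ^+ 2) + 2 * lam 0 * th 0 * (f (x 0) - f y).

Lemma lyapunov_ge y k : argmin f y -> enorm (x k.+1 - y) ^+ 2 <= V y k.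
Proof.
move=> ymin; rewrite /V -addrA lerDl addr_ge0//.
  by rewrite mulr_ge0 ?subr_ge0.
rewrite mulr_ge0 ?subr_ge0 ?ymin// addr_ge0// ?mulr_ge0// ?ltW//.
exact: lt_le_trans w_ge1.
Qed.

Lemma lyapunov0 y : argmin f y -> V y 0 <= initial_bound y.
Proof.
move=> ymin; have F0 : 0 <= f (x 0) - f y by rewrite subr_ge0 ymin.
have h0 : f (x 0) - f y + dotv (g (x 0)) (y - x 0) <= - 0.
  by have := gle (x 0) y; lra.
have h := gradient_step_dist h0.
(* The bound w <= 2, that is omega^2 <= 1/2, is the origin of the factors 2 in eta. *)
have hA : w * A 0 <= 2 * A 0 by rewrite ler_wpM2r.
have hF : w * (lam 0 * th 0 * (f (x 0) - f y)) <= 2 * (lam 0 * th 0 * (f (x 0) - f y)).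
  by rewrite ler_wpM2r// !mulr_ge0// ltW.
rewrite /V /initial_bound -/(A 0); lra.
Qed.

Lemma lyapunov_nonincreasing y : argmin f y -> nonincreasing_seq (V y).
Proof.
move=> ymin; apply/nonincreasing_seqP => k.
have := @lyapunov_step y 0 k ymin; rewrite mulr0 addr0; apply.
by have := gle (x k.+1) y; lra.
Qed.

Lemma iterates_dist_le y k : argmin f y -> enorm (x k - y) ^+ 2 <= initial_bound y.
Proof.
move=> ymin; case: k => [|k].
  rewrite /initial_bound -addrA lerDl addr_ge0//.
    by rewrite mulr_ge0// mulr_ge0 ?sqr_ge0.
  by rewrite !mulr_ge0// ?subr_ge0 ?ymin// ltW.
apply: (le_trans (lyapunov_ge k ymin)); apply: le_trans (lyapunov0 ymin).
exact: lyapunov_nonincreasing.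
Qed.

Lemma lyapunov_cvg y : argmin f y -> cvg (V y @ \oo).
Proof.
move=> ymin; apply: nonincreasing_is_cvgn; first exact: lyapunov_nonincreasing.
exists 0 => _ [k _ <-]; apply: le_trans (lyapunov_ge k ymin).
exact: sqr_ge0.
Qed.

Lemma iterates_dist_diff_cvg y1 y2 : argmin f y1 -> argmin f y2 ->
  cvg (enorm (x k - y1) ^+ 2 - enorm (x k - y2) ^+ 2 @[k --> \oo]).
Proof.
move=> m1 m2; have fy : f y1 = f y2 by apply/eqP; rewrite eq_le m1 m2.
have Vl := cvgB (lyapunov_cvg m1) (lyapunov_cvg m2).
(* The energy at k contains [x k.+1], hence the shift; the remaining terms cancel because both
   minimizers have the same value. *)
apply/cvg_ex; exists (lim (V y1 @ \oo) - lim (V y2 @ \oo)); rewrite -cvg_shiftS.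
rewrite [X in X @ _](_ : _ = V y1 \- V y2); first exact: Vl.
by apply/funext => k; rewrite /V fy /=; lra.
Qed.

(** * Step-size lower bound, summable gradients and convergence of the iterates *)

Section Rate.
Variables (y : 'rV[R]_n) (D L : R).
Hypotheses (ymin : argmin f y) (gy0 : g y = 0) (L_gt0 : 0 < L).
Hypothesis lip : forall u v, enorm (u - y) <= D -> enorm (v - y) <= D ->
  enorm (g u - g v) <= L * enorm (u - v).
Hypothesis xD : forall k, enorm (x k - y) <= D.
Hypothesis lam_low : forall k, lam k <= lam k.+1 \/
  x k.+1 != x k /\ om * enorm (x k.+1 - x k) <= lam k.+1 * enorm (g (x k.+1) - g (x k)).

(** By induction: a step either does not shrink, or it is at least omega divided by a local
    curvature estimate, which is at most [L] on the ball. *)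
Lemma stepsize_ge k : Num.min (lam 0) (om / L) <= lam k.
Proof.
elim: k => [|k IHk]; first by rewrite ge_min lexx.
have [/(le_trans IHk)//|[xk h]] := lam_low k.
rewrite ge_min; apply/orP; right; rewrite ler_pdivrMr//.
have dx : 0 < enorm (x k.+1 - x k) by rewrite lt_def enorm_eq0 subr_eq0 xk enorm_ge0.
rewrite -(ler_pM2r dx); apply: (le_trans h).
by rewrite -mulrA ler_pM2l// lip.
Qed.

Lemma sqr_gradient_sum_le N :
  Num.min (lam 0) (om / L) / (2 * L) * (\sum_(0 <= k < N) enorm (g (x k.+1)) ^+ 2)
    + V y N <= V y 0.
Proof.
elim: N => [|N IHN]; first by rewrite big_nil mulr0 add0r.
apply: le_trans IHN; rewrite big_nat_recr//= mulrDr -addrA lerD2l.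
have hc := cocoercive_at_critical_point gle L_gt0 lip gy0 (xD N.+1).
apply: le_trans (lyapunov_step ymin hc); rewrite [leRHS]addrC lerD2r.
have -> : 2 * lam N.+1 * (enorm (g (x N.+1)) ^+ 2 / (4 * L))
    = lam N.+1 / (2 * L) * enorm (g (x N.+1)) ^+ 2.
  by field; rewrite gt_eqF.
rewrite ler_wpM2r ?sqr_ge0// ler_wpM2r ?stepsize_ge//.
by rewrite invr_ge0 ltW// mulr_gt0.
Qed.

Lemma sqr_gradient_series_cvg : cvg (series (fun k => enorm (g (x k)) ^+ 2) @ \oo).
Proof.
set c := Num.min (lam 0) (om / L) / (2 * L).
have c0 : 0 < c by rewrite divr_gt0 ?mulr_gt0// lt_min lam_gt0 divr_gt0.
apply: nondecreasing_is_cvgn.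
  by apply: nondecreasing_series => k _ _; exact: sqr_ge0.
exists (enorm (g (x 0)) ^+ 2 + V y 0 / c) => _ [N _ <-].
(* The telescoped bound starts at [x 1], so one term is added at the end to split off the gradient
   at [x 0]. *)
apply: (@le_trans _ _ (series (fun k => enorm (g (x k)) ^+ 2) N.+1)).
  by rewrite /series/= big_nat_recr//= lerDl sqr_ge0.
rewrite /series/= big_nat_recl//= lerD2l ler_pdivlMr// mulrC.
apply: le_trans (sqr_gradient_sum_le N); rewrite lerDl.
exact: le_trans (sqr_ge0 _) (lyapunov_ge N ymin).
Qed.

Lemma gradient_cvg0 : enorm (g (x k)) @[k --> \oo] --> (0 : R).
Proof.
have h := cvg_series_cvg_0 sqr_gradient_series_cvg.
have -> : (fun k => enorm (g (x k))) = (fun k => Num.sqrt (enorm (g (x k)) ^+ 2)).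
  by apply/funext => k; rewrite sqrtr_sqr ger0_norm ?enorm_ge0.
rewrite -sqrtr0; apply: (cvg_comp _ _ h); exact: sqrt_continuous.
Qed.

Lemma iterates_cvg : locally_lipschitz g ->
  exists2 z, argmin f z & x k @[k --> \oo] --> z.
Proof.
move=> glip.
have clmin z : cluster (x @ \oo) z -> argmin f z.
  move=> zcl; apply: (critical_argmin gle); apply/eqP; rewrite -enorm_eq0; apply/eqP.
  apply: (cluster_cvg_continuous zcl (phi := fun u => enorm (g u))).
    exact: locally_lipschitz_enorm_continuous.
  exact: gradient_cvg0.
have [|z zcl xz] := opial_cvg xD.
  by move=> z1 z2 /clmin m1 /clmin m2; exact: iterates_dist_diff_cvg.
by exists z => //; exact: clmin.
Qed.

End Rate.

End AdaptiveDescent.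

(** * Real-number facts on the step rule, the optimal value and the distance *)

Section StepSizes.
Variable R : realType.

(** Shows that replacing the distance to the solution set by the distance to an [e]-almost nearest
    solution costs at most [e] in the square root of eta. *)
Lemma sqrt_sqrD_le (c d e s : R) : 0 <= c -> 0 <= d -> 0 <= e -> 0 <= s -> s <= d + e ->
  Num.sqrt (s ^+ 2 + c) <= Num.sqrt (d ^+ 2 + c) + e.
Proof.
move=> c0 d0 e0 s0 sde.
have dq : d <= Num.sqrt (d ^+ 2 + c).
  by rewrite -[X in X <= _](ger0_norm d0) -sqrtr_sqr ler_wsqrtr// lerDl.
rewrite -(@ler_pXn2r _ 2) ?nnegrE ?addr_ge0 ?sqrtr_ge0//.
rewrite sqrrD !sqr_sqrtr ?addr_ge0 ?sqr_ge0//.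
have : s ^+ 2 <= (d + e) ^+ 2 by rewrite ler_pXn2r ?nnegrE ?addr_ge0.
have := ler_wpM2r e0 dq; rewrite sqrrD; lra.
Qed.

                                                                           
                                                                            
(** Here [u] and [v] stand for the norms of the gradient difference and of the displacement. The
    conclusion gathers all that the analysis uses of the minimum: both upper bounds, and that one of
    them is attained. *)
Lemma min_stepsizeP (lam c S om u v : R) : 0 < lam -> 0 < c -> 0 < S -> 0 < om ->
  0 <= u -> 0 <= v -> (v = 0 -> u = 0) ->
  let t := lam / c * Num.sqrt S in
  let a := if u / v == 0 then t else Num.min t (om / (c * (u / v))) in
  [/\ 0 < a * c, a * c <= lam * Num.sqrt S, a * c * u <= om * v &
      a * c = lam * Num.sqrt S \/ v != 0 /\ om * v <= a * c * u].
Proof.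
move=> lam0 c0 S0 om0 u0 v0 vu t a.
have tc : t * c = lam * Num.sqrt S by rewrite /t; field; rewrite gt_eqF.
have t0 : 0 < t by rewrite mulr_gt0 ?divr_gt0 ?sqrtr_gt0.
(* Since division by 0 yields 0, this case includes v = 0. Either way u = 0 and the curvature bound
   is trivial. *)
have [uv|uv] := eqVneq (u / v) 0.
  have u00 : u = 0.
    by move/eqP: uv; rewrite mulf_eq0 invr_eq0 => /orP[/eqP//|/eqP].
  rewrite /a uv eqxx tc u00 mulr0; split => //; [|by rewrite mulr_ge0// ltW|by left].
  by rewrite mulr_gt0 ?sqrtr_gt0.
have v_neq0 : v != 0 by apply: contra_neq uv => ->; rewrite invr0 mulr0.
have u_neq0 : u != 0 by apply: contra_neq uv => ->; rewrite mul0r.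
have vp : 0 < v by rewrite lt_def v_neq0.
have up : 0 < u by rewrite lt_def u_neq0.
have kc : om / (c * (u / v)) * c * u = om * v.
  by field; rewrite !gt_eqF.
rewrite /a (negbTE uv).
have a0 : 0 < Num.min t (om / (c * (u / v))).
  by rewrite lt_min t0 divr_gt0// mulr_gt0// divr_gt0.
split.
- by rewrite mulr_gt0.
- by rewrite -tc ler_pM2r// ge_min lexx.
- by rewrite -kc !ler_pM2r// ge_min lexx orbT.
- have [h|h] := leP t (om / (c * (u / v))); first by left.
  by right; split => //; rewrite kc.
Qed.

Lemma sqr_le_half (om : R) : 0 < om -> om <= 1 / Num.sqrt 2 -> 2 * om ^+ 2 <= 1.
Proof.
move=> om0 h; have : om ^+ 2 <= (1 / Num.sqrt 2) ^+ 2.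
  by rewrite ler_pXn2r ?nnegrE ?divr_ge0 ?sqrtr_ge0 ?(ltW om0).
by rewrite exprMn expr1n exprVn sqr_sqrtr//; lra.
Qed.

Lemma optval_argmin (n : nat) (f : 'rV[R]_n -> R) y : argmin f y -> optval f = f y.
Proof.
move=> ymin; apply/eqP; rewrite eq_le; apply/andP; split.
  by apply: ge_inf; [exists (f y) => _ [z _ <-]; exact: ymin|exists y].
by apply: lb_le_inf; [exists (f y), y|move=> _ [z _ <-]; exact: ymin].
Qed.

Lemma dist_set_ge0 (n : nat) (x0 : 'rV[R]_n) S :
  S !=set0 -> 0 <= dist_set x0 S.
Proof.
move=> [s Ss]; apply: lb_le_inf; first by exists (enorm (s - x0)), s.
by move=> _ [z _ <-]; exact: enorm_ge0.
Qed.

Lemma dist_set_approx (n : nat) (x0 : 'rV[R]_n) S (e : R) : S !=set0 -> 0 < e ->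
  exists2 y, S y & enorm (y - x0) < dist_set x0 S + e.
Proof.
move=> [s Ss] e0; have [|_ [y Sy <-] ye] := @inf_adherent _ [set enorm (z - x0) | z in S] _ e0.
  split; first by exists (enorm (s - x0)), s.
  by exists 0 => _ [z _ <-]; exact: enorm_ge0.
by exists y.
Qed.

End StepSizes.

(** * The AdaSGA recursion satisfies the abstract hypotheses *)

Section AdaSGA.
Variables (R : realType) (n : nat) (f : 'rV[R]_n -> R) (x0 : 'rV[R]_n).
Variables (alpha0 theta0 tau omega : R) (gamma : nat -> R).
Hypotheses (alpha0_gt0 : 0 < alpha0) (theta0_gt0 : 0 < theta0) (tau_ge1 : 1 <= tau).
Hypotheses (omega_gt0 : 0 < omega) (omega2 : 2 * omega ^+ 2 <= 1).
Hypothesis gamma_gt0 : forall k, 0 < gamma k.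

Let x k := ada_x f gamma x0 alpha0 theta0 tau omega k.

Definition ada_length k := (ada_state f gamma x0 alpha0 theta0 tau omega k).1.2 * gamma k.
Definition ada_theta k := (ada_state f gamma x0 alpha0 theta0 tau omega k).2.

Lemma ada_xS k : x k.+1 = x k - ada_length k *: grad f (x k).
Proof. by rewrite /x /ada_x /ada_length /=; case: ada_state => [[]]. Qed.

Lemma ada_thetaS k : ada_theta k.+1 = ada_length k.+1 / ada_length k.
Proof. by rewrite /ada_theta /ada_length /=; case: ada_state => [[]]. Qed.

Let u k := enorm (grad f (x k.+1) - grad f (x k)).
Let v k := enorm (x k.+1 - x k).
Let S k := 2 * (1 - omega ^+ 2) + ada_theta k / tau.

Let ada_lengthS k : ada_length k.+1 =
  (if u k / v k == 0 then ada_length k / gamma k.+1 * Num.sqrt (S k)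
   else Num.min (ada_length k / gamma k.+1 * Num.sqrt (S k))
                (omega / (gamma k.+1 * (u k / v k)))) * gamma k.+1.
Proof.
by rewrite /u /v ada_xS /S /x /ada_x /ada_length /ada_theta /=; case: ada_state => [[]].
Qed.

Let S_ge1 k : 0 < ada_theta k -> 1 <= S k.
Proof.
move=> th0; have : 0 <= ada_theta k / tau by rewrite divr_ge0 ?ltW// (lt_le_trans ltr01).
by rewrite /S; move: omega2; lra.
Qed.

Let ada_stepP k : 0 < ada_length k -> 0 < ada_theta k ->
  [/\ 0 < ada_length k.+1, ada_length k.+1 <= ada_length k * Num.sqrt (S k),
      ada_length k.+1 * u k <= omega * v k &
      ada_length k.+1 = ada_length k * Num.sqrt (S k) \/
      v k != 0 /\ omega * v k <= ada_length k.+1 * u k].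
Proof.
move=> lam0 th0; rewrite ada_lengthS.
apply: min_stepsizeP; rewrite ?enorm_ge0//.
  exact: lt_le_trans (S_ge1 th0).
move/eqP; rewrite enorm_eq0 subr_eq0 => /eqP xk.
by apply/eqP; rewrite /u xk enorm_eq0 subrr.
Qed.

Lemma ada_pos k : 0 < ada_length k /\ 0 < ada_theta k.
Proof.
elim: k => [|k [lam0 th0]]; first by rewrite /ada_length mulr_gt0.
by have [h _ _ _] := ada_stepP lam0 th0; rewrite ada_thetaS divr_gt0.
Qed.

(** The first term of the minimum bounds theta_{k+1} by a square root, and tau >= 1 lets theta_k /
    tau be replaced by theta_k. *)
Lemma ada_theta_sqr_le k : ada_theta k.+1 ^+ 2 <= 2 * (1 - omega ^+ 2) + ada_theta k.
Proof.
have [lam0 th0] := ada_pos k; have [lam10 h _ _] := ada_stepP lam0 th0.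
apply: (@le_trans _ _ (S k)); last first.
  by rewrite lerD2l ler_pdivrMr ?(lt_le_trans ltr01)// ler_peMr// ltW.
have S0 : 0 <= S k by rewrite (le_trans ler01)// S_ge1.
rewrite -[leRHS](sqr_sqrtr S0) ler_pXn2r ?nnegrE ?sqrtr_ge0//.
  by rewrite ada_thetaS ler_pdivrMr// mulrC.
by rewrite ltW//; case: (ada_pos k.+1).
Qed.

Lemma ada_length_gradient k :
  ada_length k.+1 * enorm (grad f (x k.+1) - grad f (x k)) <= omega * enorm (x k.+1 - x k).
Proof. by have [lam0 th0] := ada_pos k; have [] := ada_stepP lam0 th0. Qed.

(** When the first term of the minimum is active the step cannot shrink, because 2(1 - omega^2) >=
    1. *)
Lemma ada_length_low k : ada_length k <= ada_length k.+1 \/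
  x k.+1 != x k /\
  omega * enorm (x k.+1 - x k) <= ada_length k.+1 * enorm (grad f (x k.+1) - grad f (x k)).
Proof.
have [lam0 th0] := ada_pos k; have [_ _ _ [->|[v0 h]]] := ada_stepP lam0 th0.
  by left; rewrite ler_peMr ?(ltW lam0)// -[leLHS]sqrtr1 ler_wsqrtr// S_ge1.
by right; split => //; rewrite -subr_eq0 -enorm_eq0.
Qed.

End AdaSGA.

Theorem theorem4p3 (R : realType) (n : nat) (f : 'rV[R]_n -> R)
  (x0 : 'rV[R]_n) (alpha0 theta0 tau omega gmin gmax : R) (gamma : nat -> R) (r : R) :
  convex_fun f ->
  (forall x, differentiable f x) ->
  locally_lipschitz (grad f) ->
  argmin f !=set0 ->
  0 < alpha0 -> 0 < theta0 -> 1 <= tau ->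
  0 < omega -> omega <= 1 / Num.sqrt 2 ->
  0 < gmin -> (forall k, gmin <= gamma k <= gmax) ->
  let x := ada_x f gamma x0 alpha0 theta0 tau omega in
  let eta := dist_set x0 (argmin f) ^+ 2
             + 2 * alpha0 ^+ 2 * gamma 0%N ^+ 2 * enorm (grad f x0) ^+ 2
             + 2 * alpha0 * gamma 0%N * theta0 * (f x0 - optval f) in
  Num.sqrt eta + dist_set x0 (argmin f) + enorm x0 < r ->
           
  (forall k, enorm (x k) < r) /\
           
  cvg (series (fun k => enorm (grad f (x k)) ^+ 2) @ \oo) /\
  (enorm (grad f (x k)) @[k --> \oo] --> (0 : R)) /\
           
  (exists2 xs, argmin f xs /\ enorm xs < r & x k @[k --> \oo] --> xs).

Proof.
move=> fconv df glip [s smin] a0 t0 tau1 om0 om1 gmin0 gammaP x eta etar.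
set g := grad f.
have gle : forall y z, f y + dotv (g y) (z - y) <= f z by exact: convex_grad_le.
have om2 := sqr_le_half om0 om1.
have gam0 k : 0 < gamma k by have /andP[h _] := gammaP k; exact: lt_le_trans h.
pose w := (1 - omega ^+ 2)^-1.
have wE : w * (1 - omega ^+ 2) = 1.
  by rewrite mulVf// gt_eqF// subr_gt0; move: om2; lra.
pose lam := ada_length f x0 alpha0 theta0 tau omega gamma.
pose th := ada_theta f x0 alpha0 theta0 tau omega gamma.
have pos k : 0 < lam k /\ 0 < th k by exact: ada_pos.
have lam0 k := (pos k).1; have th0 := (pos 0%N).2.
have xS k : x k.+1 = x k - lam k *: g (x k) by exact: ada_xS.
have thS k : th k.+1 = lam k.+1 / lam k by exact: ada_thetaS.
have th2 k : th k.+1 ^+ 2 <= 2 * (1 - omega ^+ 2) + th k by exact: ada_theta_sqr_le.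
have lamg k : lam k.+1 * enorm (g (x k.+1) - g (x k)) <= omega * enorm (x k.+1 - x k).
  exact: ada_length_gradient.
have lamlow k : lam k <= lam k.+1 \/ x k.+1 != x k /\
    omega * enorm (x k.+1 - x k) <= lam k.+1 * enorm (g (x k.+1) - g (x k)).
  exact: ada_length_low.
set d := dist_set x0 (argmin f).
have argmin0 : argmin f !=set0 by exists s.
have d0 : 0 <= d by exact: dist_set_ge0.
pose e := (r - (Num.sqrt eta + d + enorm x0)) / 2.
have e0 : 0 < e by rewrite divr_gt0// subr_gt0.
have [y ymin yd] := dist_set_approx x0 argmin0 e0; rewrite -/d in yd.
pose c := 2 * (lam 0%N ^+ 2 * enorm (g x0) ^+ 2) + 2 * lam 0%N * th 0%N * (f x0 - f y).
have c0 : 0 <= c.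
  rewrite addr_ge0//; first by rewrite mulr_ge0// mulr_ge0 ?sqr_ge0.
  by rewrite !mulr_ge0 ?subr_ge0 ?ymin// ltW.
have etaE : eta = d ^+ 2 + c.
  rewrite /eta (optval_argmin ymin) -/d -/g /c /lam /th /ada_length /ada_theta /=; ring.
have D_le : Num.sqrt (enorm (y - x0) ^+ 2 + c) <= Num.sqrt eta + e.
  by rewrite etaE sqrt_sqrD_le ?enorm_ge0 ?(ltW e0) ?(ltW yd).
set D := Num.sqrt (enorm (y - x0) ^+ 2 + c) in D_le.
have xD k : enorm (x k - y) <= D.
  have := iterates_dist_le gle om0 om2 lam0 th0 xS thS th2 lamg wE k ymin.
  rewrite /initial_bound -addrA -/c (enorm_distC (x 0%N) y) => h.
  by rewrite -(ger0_norm (enorm_ge0 (x k - y))) -sqrtr_sqr; exact: ler_wsqrtr.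
have xr k : enorm (x k) <= D + enorm (y - x0) + enorm x0.
  rewrite -[x k](subrK y) (le_trans (ler_enormD _ _))// -addrA lerD//.
  by rewrite -{1}[y](subrK x0) ler_enormD.
have Dr : D + enorm (y - x0) + enorm x0 < r.
  have er : e * 2 = r - (Num.sqrt eta + d + enorm x0) by rewrite /e; field.
  by move: D_le yd er; lra.
have [L L0 lip] := locally_lipschitz_compact glip (@compact_enorm_ball R n y D).
have gy0 : g y = 0 by exact: argmin_grad.
split; first by move=> k; exact: le_lt_trans (xr k) Dr.
split; first exact: (sqr_gradient_series_cvg gle om0 om2 lam0 th0 xS thS th2 lamg wE ymin gy0 L0 lip xD lamlow).
split; first exact: (gradient_cvg0 gle om0 om2 lam0 th0 xS thS th2 lamg wE ymin gy0 L0 lip xD lamlow).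
have [z zmin xz] := iterates_cvg gle om0 om2 lam0 th0 xS thS th2 lamg wE ymin gy0 L0 lip xD lamlow glip.
(* A limit keeps only weak inequalities; the uniform bound strictly below [r] puts the limit in the
   open ball. *)
exists z => //; split=> //; apply: le_lt_trans Dr.
apply: (cvgr_to_le (cvg_enorm _ xz)); exact: nearW.
Qed.
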